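(* Let $\delta_1,\dots,\delta_N>0$ and $R>0$ be real numbers with \[ \sum_{k=1}^N\delta_k^2<R^2 . \] Then the ball $B^{2d}(R)\subset\mathbb C^d$ cannot be covered by a union of $N$ cylinders such that, for each $k=1,\dots,N$, the $k$-th cylinder is the $\delta_k$-neighborhood of a complex affine hyperplane in $\mathbb C^d$.
   Context: $B^{2d}(R)=\{z\in\mathbb C^d : |z|\le R\}$ is the closed ball of radius $R>0$ centered at the origin, where $|z|^2=|z_1|^2+\dots+|z_d|^2$. A complex affine hyperplane is a translate of a complex linear subspace of complex dimension $d-1$. The $\delta$-neighborhood of a complex affine hyperplane $H$ is the set of points of $\mathbb C^d$ at Euclidean distance at most $\delta$ from $H$; equivalently, it has the form $\{x\in\mathbb C^d : |\langle x-y,u\rangle|\le\delta\}$ with $y\in\mathbb C^d$, $u\in\mathbb C^d$ a unit vector, and $\langle\cdot,\cdot\rangle$ the standard Hermitian product. *)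

(* Defs.v *)
From HB Require Import structures.
From mathcomp Require Import all_boot all_order all_algebra.
From mathcomp Require Import classical_sets reals.
From mathcomp Require Import complex.

Set Implicit Arguments.
Unset Strict Implicit.
Unset Printing Implicit Defensive.

Import Order.TTheory GRing.Theory Num.Theory.

Local Open Scope classical_set_scope.
Local Open Scope ring_scope.

(* The norm that matrices inherit from the library is the sup norm, so the
   Hermitian norm of C^d, with values in [R], is defined here;
   [Normc.normc : R[i] -> R] is the modulus. *)
Definition enorm (R : realType) (d : nat) (z : 'rV[R[i]]_d) : R :=
  Num.sqrt (\sum_(j < d) Normc.normc (z 0 j) ^+ 2).

Definition closed_eball (R : realType) (d : nat) (r : R) : set 'rV[R[i]]_d :=
  [set z | enorm z <= r].

(* The dimension condition is written [(\dim V).+1 = d] and not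
   [\dim V = d.-1] so that there is no hyperplane when [d = 0]. *)
Definition affine_hyperplane (R : realType) (d : nat)
    (H : set 'rV[R[i]]_d) : Prop :=
  exists (y : 'rV[R[i]]_d) (V : {vspace 'rV[R[i]]_d}),
    (\dim V).+1 = d /\ H = [set y + v | v in [set v | v \in V]].

Definition edist_to (R : realType) (d : nat) (z : 'rV[R[i]]_d)
    (H : set 'rV[R[i]]_d) : R :=
  inf [set enorm (z - w) | w in H].

Definition neighborhood (R : realType) (d : nat) (delta : R)
    (H : set 'rV[R[i]]_d) : set 'rV[R[i]]_d :=
  [set z | edist_to z H <= delta].

(* Main.v *)
(** With [n k] and [D] natural numbers such that [n k > D * delta k ^ 2] and
    [sum_k n k <= D * r ^ 2], let [l_k] be an affine form whose modulus is the
    distance to the [k]-th hyperplane and maximize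
      [G z = (prod_k |l_k z| ^ (2 n k)) * exp (- D |z|^2)]
    over C^d. Restricted to a complex line, [G] is [exp (- D |y|^2)] times a
    constant and the squared modulus of an entire function. Comparing a maximum
    point [p] with circles on the line through 0 and [p] gives
    [D |p|^2 <= sum_k n k], so [p] lies in the ball; comparing it with circles
    centered on the [k]-th hyperplane gives [D |l_k p|^2 >= n k], so [p] lies
    outside the [k]-th cylinder. *)

Require Import Defs.
From HB Require Import structures.
From mathcomp Require Import all_boot all_order all_algebra.
From mathcomp Require Import boolp classical_sets reals.
From mathcomp Require Import complex.
From mathcomp Require Import topology normedtype sequences derive exp.
From mathcomp Require Import ring lra.

Set Implicit Arguments.
Unset Strict Implicit.
Unset Printing Implicit Defensive.

Import Order.TTheory GRing.Theory Num.Theory.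
Import numFieldNormedType.Exports.

Local Open Scope classical_set_scope.
Local Open Scope ring_scope.

(* Unqualified, [Re] and [Im] would be those of [numClosedFieldType]. *)
Local Notation Re := (@complex.Re _).
Local Notation Im := (@complex.Im _).

(** * Squared moduli and the pairing on C^d *)

Lemma ReD (R : realType) (x y : R[i]) : Re (x + y) = Re x + Re y.
Proof. by case: x y => [a b] [c e]. Qed.

Lemma ImD (R : realType) (x y : R[i]) : Im (x + y) = Im x + Im y.
Proof. by case: x y => [a b] [c e]. Qed.

Lemma ReM (R : realType) (x y : R[i]) : Re (x * y) = Re x * Re y - Im x * Im y.
Proof. by case: x y => [a b] [c e]. Qed.

Lemma ImM (R : realType) (x y : R[i]) : Im (x * y) = Re x * Im y + Im x * Re y.
Proof. by case: x y => [a b] [c e]. Qed.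

Definition sqn (R : realType) (x : R[i]) : R := Re x ^+ 2 + Im x ^+ 2.

Lemma sqn_ge0 (R : realType) (x : R[i]) : 0 <= sqn x.
Proof. by rewrite addr_ge0 ?sqr_ge0. Qed.

Lemma sqn0 (R : realType) : sqn (0 : R[i]) = 0.
Proof. by rewrite /sqn /= expr0n /= addr0. Qed.

Lemma sqnM (R : realType) (x y : R[i]) : sqn (x * y) = sqn x * sqn y.
Proof. by rewrite /sqn ReM ImM; ring. Qed.

Lemma sqn_eq0 (R : realType) (x : R[i]) : (sqn x == 0) = (x == 0).
Proof. by rewrite paddr_eq0 ?sqr_ge0 // !sqrf_eq0 eq_complex. Qed.

Lemma sqn_gt0 (R : realType) (x : R[i]) : (0 < sqn x) = (x != 0).
Proof. by rewrite lt_def sqn_ge0 andbT sqn_eq0. Qed.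

Lemma sqnV (R : realType) (x : R[i]) : sqn x^-1 = (sqn x)^-1.
Proof.
have [->|x0] := eqVneq x 0; first by rewrite invr0 sqn0 invr0.
have sx0 : sqn x != 0 by rewrite sqn_eq0.
by apply: (mulfI sx0); rewrite -sqnM !divff // /sqn /= expr1n expr0n /= addr0.
Qed.

Lemma sqn_normc (R : realType) (x : R[i]) : Normc.normc x ^+ 2 = sqn x.
Proof. by case: x => a b /=; rewrite sqr_sqrtr // addr_ge0 ?sqr_ge0. Qed.

(** No conjugation, so that [dotu z b] is holomorphic in [z]; the Hermitian product of [x] and [y]
    is [dotu x (conjv y)]. *)
Definition dotu (R : realType) d (z b : 'rV[R[i]]_d) : R[i] :=
  \sum_(j < d) z 0 j * b 0 j.

Definition hsq (R : realType) d (z : 'rV[R[i]]_d) : R := \sum_(j < d) sqn (z 0 j).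

Lemma hsq_ge0 (R : realType) d (z : 'rV[R[i]]_d) : 0 <= hsq z.
Proof. by apply: sumr_ge0 => j _; exact: sqn_ge0. Qed.

Lemma dotuDl (R : realType) d (x y b : 'rV[R[i]]_d) :
  dotu (x + y) b = dotu x b + dotu y b.
Proof. by rewrite -big_split; apply: eq_bigr => j _; rewrite mxE mulrDl. Qed.

Lemma dotuZl (R : realType) d t (x b : 'rV[R[i]]_d) :
  dotu (t *: x) b = t * dotu x b.
Proof. by rewrite mulr_sumr; apply: eq_bigr => j _; rewrite mxE mulrA. Qed.

Lemma hsqZ (R : realType) d t (x : 'rV[R[i]]_d) : hsq (t *: x) = sqn t * hsq x.
Proof. by rewrite mulr_sumr; apply: eq_bigr => j _; rewrite mxE sqnM. Qed.

Definition conjv (R : realType) d (x : 'rV[R[i]]_d) : 'rV[R[i]]_d :=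
  \row_j (x 0 j)^*%C.

Lemma hsqD (R : realType) d (x y : 'rV[R[i]]_d) :
  hsq (x + y) = hsq x + 2 * Re (dotu x (conjv y)) + hsq y.
Proof.
rewrite /hsq /dotu (big_morph (@complex.Re R) (@ReD R) (erefl : Re 0 = 0)) mulr_sumr.
rewrite -!big_split /=; apply: eq_bigr => j _.
by rewrite !mxE; case: (x 0 j) => a b; case: (y 0 j) => e f; rewrite /sqn /=; ring.
Qed.

(** * Continuity, and maxima on balls *)

(** The parameters [beta] and [c] let one existence result for maxima serve twice: [gaussian] is the
    case [beta = 0], [c = - D], and [expoly] is the case of dimension 1. *)
Definition gauss_prod (R : realType) d N (n : 'I_N -> nat) (a : 'I_N -> R[i])
    (b : 'I_N -> 'rV[R[i]]_d) (beta : 'rV[R[i]]_d) (c : R) (z : 'rV[R[i]]_d) : R :=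
  (\prod_(k < N) sqn (a k + dotu z (b k)) ^+ n k)
  * expR (Re (dotu z beta) + c * hsq z).

Lemma continuous_bigr (R : realType) (T : topologicalType) (I : Type)
    (op : R -> R -> R) (idx : R) (s : seq I) (f : I -> T -> R) :
  (forall g h : T -> R, continuous g -> continuous h ->
    continuous (fun x => op (g x) (h x))) ->
  (forall i, continuous (f i)) ->
  continuous (fun x => \big[op/idx]_(i <- s) f i x).
Proof.
move=> opc fc; elim: s => [|i s IH].
  by under eq_fun do rewrite big_nil; move=> x; exact: cst_continuous.
by under eq_fun do rewrite big_cons; apply: opc.
Qed.

Lemma continuousDr (R : realType) (T : topologicalType) (g h : T -> R) :
  continuous g -> continuous h -> continuous (fun x => g x + h x).
Proof. by move=> gc hc x; apply: continuousD; [exact: gc|exact: hc]. Qed.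

Lemma continuousMr (R : realType) (T : topologicalType) (g h : T -> R) :
  continuous g -> continuous h -> continuous (fun x => g x * h x).
Proof. by move=> gc hc x; apply: continuousM; [exact: gc|exact: hc]. Qed.

Lemma continuousXr (R : realType) (T : topologicalType) (g : T -> R) n :
  continuous g -> continuous (fun x => g x ^+ n).
Proof.
move=> gc; elim: n => [|n IH].
  by under eq_fun do rewrite expr0; move=> x; exact: cst_continuous.
by under eq_fun do rewrite exprS; apply: continuousMr.
Qed.

(** Real coordinates on C^d: continuity and compactness are established in R^(2d) and transferred
    through this surjection. *)
Definition rV_complex (R : realType) d (x : 'rV[R]_(d + d)) : 'rV[R[i]]_d :=
  \row_j Complex (x 0 (lshift d j)) (x 0 (rshift d j)).

Lemma rV_complex_surj (R : realType) d (z : 'rV[R[i]]_d) :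
  exists x, rV_complex x = z.
Proof.
exists (row_mx (\row_j Re (z 0 j)) (\row_j Im (z 0 j))).
by apply/rowP => j; rewrite mxE row_mxEl row_mxEr !mxE; case: (z 0 j).
Qed.

Lemma continuous_hsq (R : realType) d :
  continuous (fun x : 'rV[R]_(d + d) => hsq (rV_complex x)).
Proof.
apply: continuous_bigr => [|j]; first exact: continuousDr.
under eq_fun do rewrite mxE.
by apply: continuousDr; apply: continuousXr => x; exact: coord_continuous.
Qed.

Lemma continuous_dotu (R : realType) d (b : 'rV[R[i]]_d) :
  continuous (fun x : 'rV[R]_(d + d) => Re (dotu (rV_complex x) b)) /\
  continuous (fun x : 'rV[R]_(d + d) => Im (dotu (rV_complex x) b)).
Proof.
have cc (g h : 'rV[R]_(d + d) -> R) (u v : R) : continuous g -> continuous h ->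
    continuous (fun x => g x * u + h x * v).
  by move=> gc hc; apply: continuousDr; apply: continuousMr => // x;
    exact: cst_continuous.
split.
  under eq_fun do rewrite /dotu (big_morph (@complex.Re R) (@ReD R) (erefl : Re 0 = 0)).
  apply: continuous_bigr => [|j]; first exact: continuousDr.
  under eq_fun do rewrite ReM mxE /= -mulrN.
  by apply: cc => x; exact: coord_continuous.
under eq_fun do rewrite /dotu (big_morph (@complex.Im R) (@ImD R) (erefl : Im 0 = 0)).
apply: continuous_bigr => [|j]; first exact: continuousDr.
under eq_fun do rewrite ImM mxE /=.
by apply: cc => x; exact: coord_continuous.
Qed.

Lemma continuous_gauss_prod (R : realType) d N (n : 'I_N -> nat) (a : 'I_N -> R[i])
    (b : 'I_N -> 'rV[R[i]]_d) (beta : 'rV[R[i]]_d) (c : R) :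
  continuous (fun x : 'rV[R]_(d + d) => gauss_prod n a b beta c (rV_complex x)).
Proof.
apply: continuousMr.
  apply: continuous_bigr => [|k]; first exact: continuousMr.
  have [cr ci] := continuous_dotu (b k).
  apply: continuousXr; rewrite /sqn; under eq_fun do rewrite ReD ImD.
  by apply: continuousDr; apply: continuousXr; apply: continuousDr => // x;
    exact: cst_continuous.
move=> x; apply: (@continuous_comp _ _ _
  (fun y => Re (dotu (rV_complex y) beta) + c * hsq (rV_complex y)) (@expR R));
  last exact: continuous_expR.
move: x.
apply: continuousDr; first by have [] := continuous_dotu beta.
by apply: continuousMr; [move=> y; exact: cst_continuous|exact: continuous_hsq].
Qed.

Lemma compact_hsq_le (R : realType) d (rho : R) :
  compact [set x : 'rV[R]_(d + d) | hsq (rV_complex x) <= rho].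
Proof.
apply: bounded_closed_compact.
  (* The bound [1 + rho] avoids a square root: [t ^+ 2 <= rho] implies [t <= 1 + rho]. *)
  exists (1 + rho); split; first exact: num_real.
  move=> M ltM x /= xle.
  have rho0 : 0 <= rho by apply: le_trans xle; exact: hsq_ge0.
  have [->|nx0] := eqVneq x 0; first by rewrite normr0 (le_trans _ (ltW ltM)) // addr_ge0.
  have nx1 : mx_norm x != 0 by apply: contra nx0 => /eqP/mx_norm_eq0 ->.
  have [[i j] /= xE] := mx_norm_neq0 nx1.
  rewrite [`|x|]xE (le_trans _ (ltW ltM)) //.
  have coord_le : x i j ^+ 2 <= rho.
    apply: le_trans xle; rewrite /hsq ord1.
    case: (split_ordP j) => k ->; rewrite (bigD1 k) //= mxE /sqn /=.
      by rewrite -addrA lerDl addr_ge0 ?sqr_ge0 // sumr_ge0 // => l _; exact: sqn_ge0.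
    rewrite [X in X + _]addrC -addrA lerDl addr_ge0 ?sqr_ge0 // sumr_ge0 //.
    by move=> l _; exact: sqn_ge0.
  by move: coord_le; rewrite -real_normK ?num_real //; nra.
have -> : [set x : 'rV[R]_(d + d) | hsq (rV_complex x) <= rho] =
    (fun x : 'rV[R]_(d + d) => hsq (rV_complex x)) @^-1` [set y | y <= rho] by [].
by apply: preimage_closed; [move=> x _; exact: continuous_hsq|exact: closed_le].
Qed.

Lemma gauss_prod_max (R : realType) d N (n : 'I_N -> nat) (a : 'I_N -> R[i])
    (b : 'I_N -> 'rV[R[i]]_d) (beta : 'rV[R[i]]_d) (c rho : R) :
  0 <= rho ->
  exists2 p, hsq p <= rho &
    forall z, hsq z <= rho -> gauss_prod n a b beta c z <= gauss_prod n a b beta c p.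
Proof.
move=> rho0.
have ne : [set x : 'rV[R]_(d + d) | hsq (rV_complex x) <= rho] !=set0.
  have [x xE] := rV_complex_surj (0 : 'rV[R[i]]_d); exists x => /=; rewrite xE.
  by rewrite /hsq big1 // => j _; rewrite mxE sqn0.
have [p ple pmax] := compact_EVT_max ne (@compact_hsq_le R d rho)
  (continuous_subspaceT (@continuous_gauss_prod R d N n a b beta c)).
exists (rV_complex p) => [|z]; first by move: ple; rewrite inE.
have [x <-] := rV_complex_surj z => xle; apply: pmax; by rewrite inE.
Qed.

(** * Products over four points of a circle *)

(** The error O(h^4) is relative to [c], and [f] is nonnegative even where the lower bound is
    negative; together these make the property stable under products. *)
Definition quartic_lower (R : realType) (c : R) (f : R -> R) : Prop :=
  [/\ 0 <= c, forall h, 0 <= f h &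
    exists2 C, 0 <= C & forall h, c * (1 - C * h ^+ 4) <= f h].

(** If both lower factors are positive, (1 - u)(1 - v) >= 1 - u - v for u, v >= 0; otherwise the
    claimed lower bound is at most 0. *)
Lemma quartic_lowerM (R : realType) (c1 c2 : R) (f1 f2 : R -> R) :
  quartic_lower c1 f1 -> quartic_lower c2 f2 ->
  quartic_lower (c1 * c2) (fun h => f1 h * f2 h).
Proof.
move=> [c10 f10 [C1 C10 f1le]] [c20 f20 [C2 C20 f2le]]; split.
- exact: mulr_ge0.
- by move=> h; exact: mulr_ge0.
exists (C1 + C2) => [|h]; first exact: addr_ge0.
have x0 : 0 <= h ^+ 4 by rewrite exprn_even_ge0.
move: (f1le h) (f2le h); move: (h ^+ 4) x0 => x x0 {}f1le {}f2le.
have C1x : 0 <= C1 * x by exact: mulr_ge0.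
have C2x : 0 <= C2 * x by exact: mulr_ge0.
have cc : 0 <= c1 * c2 by exact: mulr_ge0.
have [n1|p1] := lerP (1 - C1 * x) 0.
  by apply: (@le_trans _ _ 0); [apply: mulr_ge0_le0 => //; lra|exact: mulr_ge0].
have [n2|p2] := lerP (1 - C2 * x) 0.
  by apply: (@le_trans _ _ 0); [apply: mulr_ge0_le0 => //; lra|exact: mulr_ge0].
apply: (@le_trans _ _ ((c1 * (1 - C1 * x)) * (c2 * (1 - C2 * x)))); last first.
  by apply: ler_pM; rewrite ?mulr_ge0 // ltW.
have -> : (c1 * (1 - C1 * x)) * (c2 * (1 - C2 * x)) =
  c1 * c2 * ((1 - C1 * x) * (1 - C2 * x)) by ring.
by apply: ler_wpM2l => //; nra.
Qed.

Lemma quartic_lower_1 (R : realType) : quartic_lower (1 : R) (fun=> 1).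
Proof. by split=> //; exists 0 => // h; rewrite mul0r subr0 mulr1. Qed.

Lemma quartic_lowerX (R : realType) (c : R) (f : R -> R) n :
  quartic_lower c f -> quartic_lower (c ^+ n) (fun h => f h ^+ n).
Proof.
move=> cf; elim: n => [|n IH]; first exact: quartic_lower_1.
rewrite exprS; under [X in quartic_lower _ X]eq_fun do rewrite exprS.
exact: quartic_lowerM.
Qed.

Lemma quartic_lower_prod (R : realType) N (c : 'I_N -> R) (f : 'I_N -> R -> R) :
  (forall k, quartic_lower (c k) (f k)) ->
  quartic_lower (\prod_k c k) (fun h => \prod_k f k h).
Proof.
move=> cf; elim: (index_enum _) => [|k s IH].
  rewrite big_nil; under [X in quartic_lower _ X]eq_fun do rewrite big_nil.
  exact: quartic_lower_1.
rewrite big_cons; under [X in quartic_lower _ X]eq_fun do rewrite big_cons.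
exact: quartic_lowerM.
Qed.

(** A discrete, multiplicative substitute for the mean of log g over the circle of radius |h|; it
    commutes with products and powers. *)
Definition prod4 (R : realType) (g : R[i] -> R) (h : R) : R :=
  g (Complex h 0) * g (Complex (- h) 0) * (g (Complex 0 h) * g (Complex 0 (- h))).

(* The product of [L + w B] over the four points [w = h, -h, ih, -ih] is
   [L^4 - h^4 B^4]: it has no term of order 2 in [h]. *)
Lemma prod4_affine (R : realType) (L B : R[i]) :
  quartic_lower (sqn L ^+ 4) (prod4 (fun w => sqn (L + w * B))).
Proof.
split; first by rewrite exprn_ge0 ?sqn_ge0.
  by move=> h; rewrite !mulr_ge0 ?sqn_ge0.
have [->|L0] := eqVneq L 0.
  exists 0 => // h; rewrite sqn0 expr0n mul0r.
  by rewrite !mulr_ge0 ?sqn_ge0.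
(* After division by [L], the product is a multiple of |1 - h^4 w|^2, which is at least 1 - 2 h^4 Re
   w. *)
pose w := (B / L) ^+ 4.
exists (2 * `|Re w|) => [|h]; first by rewrite mulr_ge0.
have -> : prod4 (fun w => sqn (L + w * B)) h =
    sqn L ^+ 4 * sqn (1 - Complex (h ^+ 4) 0 * w).
  pose H : R[i] := Complex h 0; pose I : R[i] := Complex 0 1.
  have II : I * I = -1.
    by apply/eqP; rewrite eq_complex /=; apply/andP; split; apply/eqP; ring.
  have h4 : Complex (h ^+ 4) 0 = H ^+ 4.
    by apply/eqP; rewrite eq_complex !exprS expr0 /=; apply/andP; split; apply/eqP; ring.
  rewrite /prod4 -!sqnM.
  have -> : sqn L ^+ 4 = sqn (L ^+ 4) by rewrite !exprS !expr0 !sqnM /sqn /=; ring.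
  rewrite -sqnM; congr sqn.
  have -> : Complex (- h) 0 = - H by apply/eqP; rewrite eq_complex /= oppr0 !eqxx.
  have -> : Complex 0 h = I * H.
    by apply/eqP; rewrite eq_complex /=; apply/andP; split; apply/eqP; ring.
  have -> : Complex 0 (- h) = - (I * H).
    by apply/eqP; rewrite eq_complex /=; apply/andP; split; apply/eqP; ring.
  rewrite h4 -/H /w; have -> : B = B / L * L by rewrite divfK.
  move: (B / L) => q; rewrite mulfK //.
  transitivity ((L ^+ 2 - (H * (q * L)) ^+ 2)
    * (L ^+ 2 - I * I * (H * (q * L)) ^+ 2)); first by ring.
  by rewrite II; ring.
apply: ler_wpM2l; first by rewrite exprn_ge0 ?sqn_ge0.
have h40 : 0 <= h ^+ 4 by rewrite exprn_even_ge0.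
case: w => u v; rewrite /sqn /=.
have := ler_norm u; have := sqr_ge0 (h ^+ 4 * u); have := sqr_ge0 (h ^+ 4 * v).
by nra.
Qed.

Lemma prod4M (R : realType) (f g : R[i] -> R) h :
  prod4 (fun w => f w * g w) h = prod4 f h * prod4 g h.
Proof. by rewrite /prod4; ring. Qed.

Lemma prod4X (R : realType) (f : R[i] -> R) n h :
  prod4 (fun w => f w ^+ n) h = prod4 f h ^+ n.
Proof. by rewrite /prod4 !exprMn. Qed.

Lemma prod4_prod (R : realType) N (f : 'I_N -> R[i] -> R) h :
  prod4 (fun w => \prod_k f k w) h = \prod_k prod4 (f k) h.
Proof. by rewrite /prod4 -!big_split. Qed.

Lemma prod4_prod_affine (R : realType) N (n : 'I_N -> nat) (L B : 'I_N -> R[i]) :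
  quartic_lower ((\prod_k sqn (L k) ^+ n k) ^+ 4)
    (prod4 (fun w => \prod_k sqn (L k + w * B k) ^+ n k)).
Proof.
rewrite -prodrXl; under eq_bigr do rewrite exprAC.
have -> : prod4 (fun w => \prod_k sqn (L k + w * B k) ^+ n k) =
    fun h => \prod_k prod4 (fun w => sqn (L k + w * B k)) h ^+ n k.
  apply: funext => h; rewrite (prod4_prod (fun k w => sqn (L k + w * B k) ^+ n k)).
  by apply: eq_bigr => k _; exact: prod4X.
by apply: quartic_lower_prod => k; exact/quartic_lowerX/prod4_affine.
Qed.

(** The four increments sum to 0, so all terms linear in [w] cancel; [e * sqn w] remains, four
    times. *)
Lemma prod4_exp (R : realType) (beta y : R[i]) (e h : R) :
  prod4 (fun w => expR (Re ((y + w) * beta) + e * sqn (y + w))) h =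
  expR (Re (y * beta) + e * sqn y) ^+ 4 * expR (4 * e * h ^+ 2).
Proof.
rewrite /prod4 -!expRD -expRM_natl -expRD; congr expR.
by case: y => a b; case: beta => u v; rewrite /sqn /=; ring.
Qed.

Lemma prod4_le (R : realType) (g : R[i] -> R) h M :
  (forall w, 0 <= g w) -> 0 <= h ->
  (forall w, sqn w = h ^+ 2 -> g w <= M) -> prod4 g h <= M ^+ 4.
Proof.
move=> g0 h0 gM.
have -> : M ^+ 4 = M * M * (M * M) by ring.
have g1 : g (Complex h 0) <= M by apply: gM; rewrite /sqn /=; ring.
have g2 : g (Complex (- h) 0) <= M by apply: gM; rewrite /sqn /=; ring.
have g3 : g (Complex 0 h) <= M by apply: gM; rewrite /sqn /=; ring.
have g4 : g (Complex 0 (- h)) <= M by apply: gM; rewrite /sqn /=; ring.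
by rewrite /prod4 !ler_pM ?mulr_ge0.
Qed.

(** * The maximum principle on a complex line *)

(** For [e = 0] this is the squared modulus of the entire function prod_k (a_k + y b_k)^(n_k) exp(y
    beta / 2). A positive [e] makes its logarithm strictly subharmonic away from the zeros. *)
Definition expoly (R : realType) N (n : 'I_N -> nat) (a b : 'I_N -> R[i])
    (beta : R[i]) (e : R) (y : R[i]) : R :=
  (\prod_k sqn (a k + y * b k) ^+ n k) * expR (Re (y * beta) + e * sqn y).

Lemma expoly_disc_max (R : realType) N (n : 'I_N -> nat) (a b : 'I_N -> R[i])
    (beta : R[i]) (e rho : R) : 0 <= rho ->
  exists2 y1, sqn y1 <= rho &
    forall y, sqn y <= rho -> expoly n a b beta e y <= expoly n a b beta e y1.
Proof.
move=> rho0.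
have gE z : gauss_prod n a (fun k => const_mx (b k) : 'rV_1) (const_mx beta) e z =
    expoly n a b beta e (z 0 0).
  rewrite /gauss_prod /hsq /dotu !big_ord1 mxE; congr (_ * _).
  by apply: eq_bigr => k _; rewrite big_ord1 mxE.
have [p ple pmax] := gauss_prod_max n a (fun k => const_mx (b k) : 'rV_1)
  (const_mx beta) e rho0.
exists (p 0 0); first by move: ple; rewrite /hsq big_ord1.
move=> y yle; have := pmax (const_mx y); rewrite !gE !mxE; apply.
by rewrite /hsq big_ord1 mxE.
Qed.

(* The product over the four points around an interior maximum [y1] would exceed
   the fourth power of the maximum: the affine factors change it by O(h^4) only,
   the exponential of the linear term cancels, and [e] contributes [4 e h^2]. *)
Lemma expoly_interior (R : realType) N (n : 'I_N -> nat) (a b : 'I_N -> R[i])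
    (beta : R[i]) (e rho : R) (y1 : R[i]) : 0 < e ->
  0 < expoly n a b beta e y1 ->
  (forall y, sqn y <= rho -> expoly n a b beta e y <= expoly n a b beta e y1) ->
  rho <= sqn y1.
Proof.
move=> e0 K0 Kmax; rewrite leNgt; apply/negP => y1lt.
pose P w := \prod_k sqn (a k + y1 * b k + w * b k) ^+ n k.
pose E w := expR (Re ((y1 + w) * beta) + e * sqn (y1 + w)).
have KE w : expoly n a b beta e (y1 + w) = P w * E w.
  by congr (_ * _); apply: eq_bigr => k _; rewrite mulrDl addrA.
have P0E : \prod_k sqn (a k + y1 * b k) ^+ n k = P 0.
  by apply: eq_bigr => k _; rewrite mul0r addr0.
have [_ _ [C C0 PC]] := prod4_prod_affine n (fun k => a k + y1 * b k) b.
rewrite P0E in PC.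
pose S := `|Re y1| + `|Im y1|.
have S0 : 0 <= S by rewrite addr_ge0.
(* The first two bounds keep the four points in the disc, since 2 S h + h^2 <= (2 S + 1) h; the last
   two give C h^2 <= e and C h^2 <= 1/4. *)
pose h := Num.min (Num.min 1 ((rho - sqn y1) / (2 * S + 1)))
                  (Num.min (e / (C + 1)) (1 / (4 * (C + 1)))).
have h0 : 0 < h.
  by rewrite !lt_min ltr01 !divr_gt0 ?subr_gt0 //; lra.
have : h <= h by [].
rewrite {2}/h !le_min => /andP[/andP[h1 hrho] /andP[hC hC4]].
rewrite ler_pdivlMr in hrho; last by lra.
rewrite ler_pdivlMr in hC; last by lra.
rewrite ler_pdivlMr in hC4; last by lra.
have inside w : sqn w = h ^+ 2 -> sqn (y1 + w) <= rho.
  move=> ws.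
  have wh : `|Re w| <= h /\ `|Im w| <= h.
    by split; rewrite -(ler_pXn2r (ltn0Sn 1)) ?nnegrE ?(ltW h0) // real_normK
      ?num_real // -ws /sqn ?lerDl ?lerDr sqr_ge0.
  have : sqn (y1 + w) = sqn y1 + 2 * (Re y1 * Re w + Im y1 * Im w) + sqn w.
    by rewrite /sqn ReD ImD; ring.
  rewrite ws => ->.
  have [re im] := wh.
  have m1 : Re y1 * Re w <= `|Re y1| * h.
    by rewrite (le_trans (ler_norm _)) // normrM ler_wpM2l.
  have m2 : Im y1 * Im w <= `|Im y1| * h.
    by rewrite (le_trans (ler_norm _)) // normrM ler_wpM2l.
  have hh : h ^+ 2 <= h by rewrite expr2 ger_pMl.
  move: hrho; rewrite /S; nra.
have P4 : prod4 P h * prod4 E h <= (P 0 * E 0) ^+ 4.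
  rewrite -prod4M; apply: prod4_le => [w||w ws]; last 1 first.
  - rewrite -!KE addr0; apply: Kmax; exact: inside.
  - by rewrite -KE mulr_ge0 ?expR_ge0 // prodr_ge0 // => k _; rewrite exprn_ge0 ?sqn_ge0.
  - exact: ltW.
move: K0; rewrite -[y1]addr0 KE => K0.
have E0 : 0 < E 0 by exact: expR_gt0.
have P0 : 0 < P 0 by rewrite -(pmulr_lgt0 _ E0).
have := PC h; rewrite -/P => PCh.
move: P4; rewrite prod4_exp exprMn.
have -> : expR (Re (y1 * beta) + e * sqn y1) = E 0 by rewrite /E addr0.
rewrite mulrCA [leRHS]mulrC.
rewrite ler_pM2l ?exprn_gt0 //.
apply/negP; rewrite -ltNge.
have e1 : 1 + 4 * e * h ^+ 2 <= expR (4 * e * h ^+ 2) by exact: expR_ge1Dx.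
have P40 : 0 < P 0 ^+ 4 by rewrite exprn_gt0.
have x1 : h ^+ 2 <= 1 by rewrite expr_le1 // ltW.
have x0 : 0 < h ^+ 2 by rewrite exprn_gt0.
have xh : h ^+ 2 <= h by rewrite expr2 ger_pMl.
have h4E : h ^+ 4 = h ^+ 2 * h ^+ 2 by rewrite -exprD.
rewrite h4E in PCh.
have Cx1 : C * h ^+ 2 <= e by nra.
have Cx2 : C * h ^+ 2 <= 1 / 4 by nra.
move: (h ^+ 2) x0 x1 xh Cx1 Cx2 PCh e1 => x x0 x1 xh Cx1 Cx2 PCh e1.
have Cxx : C * (x * x) <= 1 / 4 by nra.
have pos : 0 < 1 - C * (x * x) by lra.
apply: (@lt_le_trans _ _ (P 0 ^+ 4 * (1 - C * (x * x)) * (1 + 4 * e * x))); last first.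
  apply: ler_pM => //; [by rewrite mulr_ge0 // ltW|by nra].
rewrite -mulrA ltr_pMr //.
(* Of the gain 4 e x, the terms C x^2 and 4 e x C x^2 each take at most e x, so at least 2 e x is
   left. *)
have ex : 0 < e * x by exact: mulr_gt0.
have t1 : C * (x * x) <= e * x by rewrite mulrA ler_pM2r.
have t2 : C * (x * x) * (e * x) <= 1 / 4 * (e * x) by rewrite ler_pM2r.
nra.
Qed.

(** Multiplying by exp(e |y|^2) with a small e > 0 forces the maximum over the disc onto the circle,
    by [expoly_interior]. There it is at most B exp(e rho), which is less than a value at [p]
    exceeding [B]. *)
Lemma expoly_max_principle (R : realType) N (n : 'I_N -> nat) (a b : 'I_N -> R[i])
    (beta p : R[i]) (rho B : R) :
  (forall y, sqn y = rho -> expoly n a b beta 0 y <= B) ->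
  sqn p <= rho -> expoly n a b beta 0 p <= B.
Proof.
move=> KB ple; rewrite leNgt; apply/negP => BK.
have [rho0|rho0] := lerP rho 0.
  have pE : sqn p = rho by apply/eqP; rewrite eq_le ple (le_trans rho0) ?sqn_ge0.
  by move: BK; rewrite ltNge KB.
have K_ge0 e y : 0 <= expoly n a b beta e y.
  by rewrite mulr_ge0 ?expR_ge0 // prodr_ge0 // => k _; rewrite exprn_ge0 ?sqn_ge0.
have KE e y : expoly n a b beta e y = expoly n a b beta 0 y * expR (e * sqn y).
  by rewrite /expoly mul0r addr0 -mulrA -expRD.
have B0 : 0 <= B.
  apply: le_trans (K_ge0 0 _) (KB (Complex (Num.sqrt rho) 0) _).
  by rewrite /sqn /= sqr_sqrtr ?ltW // expr0n addr0.
set K := expoly n a b beta 0 p in BK *.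
have K0 : 0 < K by exact: le_lt_trans BK.
(* Chosen so that K (1 - e rho) is the midpoint of [B] and [K]; then K exp(- e rho) > B. *)
pose e := (K - B) / (2 * K * rho).
have e0 : 0 < e by apply: divr_gt0; [rewrite subr_gt0|rewrite pmulr_lgt0 // pmulr_rgt0].
have erho : K * (1 - e * rho) = (K + B) / 2.
  by rewrite /e; field; rewrite !gt_eqF.
have [y1 y1le y1max] := expoly_disc_max n a b beta e (ltW rho0).
have Kp : K <= expoly n a b beta e p.
  rewrite KE -/K ler_peMr ?(ltW K0) // -[leLHS]expR0 ler_expR.
  by rewrite mulr_ge0 ?sqn_ge0 // ltW.
have Ky1 : K <= expoly n a b beta e y1 by exact: le_trans (y1max _ ple).
have y1E : sqn y1 = rho.
  apply/eqP; rewrite eq_le y1le; apply: expoly_interior (e0) _ (y1max).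
  exact: lt_le_trans Ky1.
move: Ky1; rewrite KE y1E; apply/negP; rewrite -ltNge.
apply: (@le_lt_trans _ _ (B * expR (e * rho))).
  by rewrite ler_wpM2r ?expR_ge0 // KB.
rewrite -ltr_pdivlMr ?expR_gt0 // -expRN.
apply: (@lt_le_trans _ _ (K * (1 - e * rho))); first by rewrite erho; lra.
by rewrite ler_pM2l // expR_ge1Dx.
Qed.

(** * The global maximum and its norm *)

(** This says that t^n exp(- D t) has its strict maximum at t = n / D, with x = D t / n. Both
    comparisons at a maximum point end with it. *)
Lemma mulr_expR1B_lt1 (R : realType) (x : R) : 0 < x -> x != 1 -> x * expR (1 - x) < 1.
Proof.
move=> x0 x1; have := @expR_gt1Dx R (x - 1); rewrite subr_eq0 => /(_ x1).
by rewrite -[1 - x]opprB expRN ltr_pdivrMr ?expR_gt0 // mul1r; lra.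
Qed.

Lemma dotu0r (R : realType) d (z : 'rV[R[i]]_d) : dotu z 0 = 0.
Proof. by rewrite /dotu big1 // => j _; rewrite mxE mulr0. Qed.

Definition gaussian (R : realType) d N (n : 'I_N -> nat) (a : 'I_N -> R[i])
  (b : 'I_N -> 'rV[R[i]]_d) (D : R) := gauss_prod n a b 0 (- D).

Lemma gaussianE (R : realType) d N (n : 'I_N -> nat) (a : 'I_N -> R[i])
    (b : 'I_N -> 'rV[R[i]]_d) (D : R) z :
  gaussian n a b D z =
  (\prod_k sqn (a k + dotu z (b k)) ^+ n k) * expR (- (D * hsq z)).
Proof. by rewrite /gaussian /gauss_prod dotu0r add0r mulNr. Qed.

(* On the complex line through 0 and [p], the substitution [s = 1 / t] turns
   the exterior of a disc into a disc; the maximum principle is applied there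
   to the reversed polynomial. *)
Lemma hsq_ball_max_le (R : realType) d N (n : 'I_N -> nat) (a : 'I_N -> R[i])
    (b : 'I_N -> 'rV[R[i]]_d) (D rho : R) (p : 'rV[R[i]]_d) :
  0 < D -> (0 < \sum_k n k)%N -> 0 < gaussian n a b D p -> hsq p <= rho ->
  (forall z, hsq z <= rho -> gaussian n a b D z <= gaussian n a b D p) ->
  D * hsq p <= (\sum_k n k)%:R.
Proof.
set M := (\sum_k n k)%N => D0 M0 Gp0 ple Gmax; rewrite leNgt; apply/negP => DP.
have MR0 : 0 < M%:R :> R by rewrite ltr0n.
(* With |y|^2 = sigma, the point p / y has D |p / y|^2 = M. As sigma > 1, it stays in the ball where
   [p] is maximal. *)
pose sigma := D * hsq p / M%:R.
have sigma1 : 1 < sigma by rewrite ltr_pdivlMr // mul1r.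
have sigma0 : 0 < sigma by exact: lt_trans sigma1.
have DPE : D * hsq p = M%:R * sigma by rewrite /sigma [RHS]mulrC divfK ?gt_eqF.
(* The reversed polynomial: [a] and [dotu p (b k)] exchange roles, so Q y = |y|^(2 M) prod_k |l_k (p
   / y)|^(2 n_k) for y != 0, and [p] corresponds to y = 1. *)
pose Q := expoly n (fun k => dotu p (b k)) a 0 0.
have QE y : Q y = \prod_k sqn (dotu p (b k) + y * a k) ^+ n k.
  by rewrite /Q /expoly mulr0 mul0r addr0 expR0 mulr1.
have Gp : gaussian n a b D p = Q 1 * expR (- (M%:R * sigma)).
  rewrite gaussianE DPE QE; congr (_ * _).
  by apply: eq_bigr => k _; rewrite mul1r addrC.
have Q10 : 0 < Q 1 by move: Gp0; rewrite Gp pmulr_lgt0 ?expR_gt0.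
have : Q 1 <= Q 1 * (sigma * expR (1 - sigma)) ^+ M.
  apply: (@expoly_max_principle _ _ _ _ _ _ _ sigma); last first.
    by rewrite /sqn /= expr1n expr0n addr0 ltW.
  move=> y ys; rewrite -/(Q y).
  have y0 : y != 0 by rewrite -sqn_gt0 ys.
  have Gy := Gmax (y^-1 *: p).
  have hy : hsq (y^-1 *: p) = sigma^-1 * hsq p by rewrite hsqZ sqnV ys.
  have Qy : Q y = sigma ^+ M * gaussian n a b D (y^-1 *: p) * expR M%:R.
    rewrite gaussianE hy -mulrA -[X in _ * X]mulrA -expRD.
    have -> : - (D * (sigma^-1 * hsq p)) + M%:R = 0.
      by rewrite mulrCA DPE mulrCA mulVf ?gt_eqF // mulr1 addNr.
    rewrite expR0 mulr1 QE -prodrXr -big_split /=; apply: eq_bigr => k _.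
    rewrite -exprMn -ys -sqnM dotuZl mulrDr mulrA divff // mul1r.
    by rewrite addrC.
  have sE : (sigma * expR (1 - sigma)) ^+ M =
      sigma ^+ M * (expR M%:R * expR (- (M%:R * sigma))).
    by rewrite exprMn -expRM_natl mulrBr mulr1 expRD.
  rewrite Qy sE.
  have -> : Q 1 * (sigma ^+ M * (expR M%:R * expR (- (M%:R * sigma)))) =
    sigma ^+ M * gaussian n a b D p * expR M%:R by rewrite Gp; ring.
  rewrite ler_wpM2r ?expR_ge0 // ler_wpM2l ?exprn_ge0 ?(ltW sigma0) // Gy //.
  rewrite hy (le_trans _ ple) // ger_pMl ?invf_le1 ?ltW //.
  have : 0 < D * hsq p by rewrite DPE mulr_gt0.
  by rewrite pmulr_rgt0.
apply/negP; rewrite -ltNge gtr_pMr // exprn_ilt1 -?lt0n //.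
- by rewrite mulr_ge0 ?expR_ge0 // ltW.
- by rewrite mulr_expR1B_lt1 // gt_eqF.
Qed.

(** A maximum over any ball, if positive, already lies in the fixed ball D |z|^2 <= M by
    [hsq_ball_max_le]. Hence the maximum over that fixed ball is global. *)
Lemma gaussian_global_max (R : realType) d N (n : 'I_N -> nat) (a : 'I_N -> R[i])
    (b : 'I_N -> 'rV[R[i]]_d) (D : R) (z0 : 'rV[R[i]]_d) :
  0 < D -> (0 < \sum_k n k)%N -> 0 < gaussian n a b D z0 ->
  exists p, [/\ 0 < gaussian n a b D p, D * hsq p <= (\sum_k n k)%:R &
    forall z, gaussian n a b D z <= gaussian n a b D p].
Proof.
set M := (\sum_k n k)%N => D0 M0 Gz0.
have rho0 : 0 <= M%:R / D by rewrite divr_ge0 // ltW.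
have [p ple pmax] := gauss_prod_max n a b 0 (- D) rho0.
have ge_p z : 0 < gaussian n a b D z -> gaussian n a b D z <= gaussian n a b D p.
  move=> Gz.
  have [q qle qmax] := gauss_prod_max n a b 0 (- D) (hsq_ge0 z).
  apply: (le_trans (qmax z (lexx _))); apply: pmax.
  rewrite ler_pdivlMr // mulrC; apply: (hsq_ball_max_le D0 M0 _ qle qmax).
  exact: lt_le_trans Gz (qmax z (lexx _)).
have Gp : 0 < gaussian n a b D p by exact: lt_le_trans (ge_p _ Gz0).
exists p; split=> // [|z]; first by rewrite mulrC -ler_pdivlMr.
have [|Gz] := ltP 0 (gaussian n a b D z); first exact: ge_p.
exact: le_trans Gz (ltW Gp).
Qed.

(** * Distance from a maximum point to the hyperplanes *)

Lemma dotu_conjv (R : realType) d (x : 'rV[R[i]]_d) : hsq x = 1 -> dotu (conjv x) x = 1.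
Proof.
move=> x1; apply/eqP; rewrite eq_complex; apply/andP; split; apply/eqP => /=.
  rewrite -x1 /dotu (big_morph (@complex.Re R) (@ReD R) (erefl : Re 0 = 0)).
  by apply: eq_bigr => j _; rewrite mxE /sqn; case: (x 0 j) => u v /=; ring.
rewrite /dotu (big_morph (@complex.Im R) (@ImD R) (erefl : Im 0 = 0)) big1 // => j _.
by rewrite mxE; case: (x 0 j) => u v /=; ring.
Qed.

Lemma conjvK (R : realType) d : involutive (@conjv R d).
Proof. by move=> x; apply/rowP => j; rewrite !mxE conjcK. Qed.

Lemma conjvZ (R : realType) d t (x : 'rV[R[i]]_d) : conjv (t *: x) = t^*%C *: conjv x.
Proof. by apply/rowP => j; rewrite !mxE rmorphM. Qed.

Lemma hsq_conjv (R : realType) d (x : 'rV[R[i]]_d) : hsq (conjv x) = hsq x.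
Proof.
by apply: eq_bigr => j _; rewrite mxE; case: (x 0 j) => u v; rewrite /sqn /= sqrrN.
Qed.

Lemma dotuZr (R : realType) d t (x b : 'rV[R[i]]_d) :
  dotu x (t *: b) = t * dotu x b.
Proof. by rewrite mulr_sumr; apply: eq_bigr => j _; rewrite mxE mulrCA. Qed.

(** The vector [conjv b] is a unit normal to the level sets of [dotu _ b]. *)
Lemma hsqD_scale_conjv (R : realType) d t (p b : 'rV[R[i]]_d) : hsq b = 1 ->
  hsq (p + t *: conjv b) = hsq p + 2 * Re (t^*%C * dotu p b) + sqn t.
Proof.
by move=> b1; rewrite hsqD hsqZ hsq_conjv b1 mulr1 conjvZ conjvK dotuZr.
Qed.

(* On the complex line through [p] orthogonal to the [k]-th hyperplane, with the
   coordinate [y] vanishing on that hyperplane, dividing out [y ^+ n k] leaves a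
   function obeying the maximum principle, whereas [|y|^(2 n k) e^(- D |y|^2)]
   increases up to [|y|^2 = n k / D]. *)
Lemma gaussian_max_far (R : realType) d N (n : 'I_N -> nat) (a : 'I_N -> R[i])
    (b : 'I_N -> 'rV[R[i]]_d) (D : R) (p : 'rV[R[i]]_d) (k : 'I_N) :
  0 < D -> (0 < n k)%N -> hsq (b k) = 1 -> 0 < gaussian n a b D p ->
  (forall z, gaussian n a b D z <= gaussian n a b D p) ->
  (n k)%:R <= D * sqn (a k + dotu p (b k)).
Proof.
move=> D0 nk0 bk1 Gp0 Gmax; rewrite leNgt; apply/negP => Dq.
have nR0 : 0 < (n k)%:R :> R by rewrite ltr0n.
set L := a k + dotu p (b k) in Dq.
(* The normal line through [p], parametrized by the value of the [k]-th form: l_k (z y) = y, and z L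
   = p. *)
pose z y := p + (y - L) *: conjv (b k).
pose B j := dotu (conjv (b k)) (b j).
pose A j := a j + dotu p (b j) - L * B j.
have lz y j : a j + dotu (z y) (b j) = A j + y * B j.
  by rewrite /z dotuDl dotuZl -/(B j) /A; ring.
have lzk y : a k + dotu (z y) (b k) = y.
  by rewrite lz /A /B dotu_conjv // -/L; ring.
have zL : z L = p by rewrite /z subrr scale0r addr0.
pose W := dotu p (b k).
(* [gamma] and [c0] collect the linear and constant parts of - D |z y|^2 as a function of [y]. *)
pose gamma := - (2 * D)%:C%C * (W^*%C - L^*%C).
pose c0 := hsq p - 2 * Re (L^*%C * W) + sqn L.
have hz y : - (D * hsq (z y)) = Re (y * gamma) - D * sqn y - D * c0.
  rewrite /z hsqD_scale_conjv // /c0 /gamma -/W.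
  case: (y) => y1 y2; case: (L) => l1 l2; case: (W) => w1 w2; rewrite /sqn /=; ring.
pose n' j := if j == k then 0%N else n j.
pose K := expoly n' A B gamma 0.
have Gz y : gaussian n a b D (z y) * expR (D * c0) =
    K y * (sqn y ^+ n k * expR (- (D * sqn y))).
  rewrite gaussianE hz /K /expoly mul0r addr0 (bigD1 k) //= lzk.
  rewrite [in RHS](bigD1 k) //= /n' eqxx expr0 mul1r.
  have -> : \prod_(i < N | i != k) sqn (A i + y * B i) ^+ (if i == k then 0 else n i)%N
      = \prod_(i < N | i != k) sqn (a i + dotu (z y) (b i)) ^+ n i.
    by apply: eq_bigr => j /negPf ->; rewrite lz.
  rewrite !expRD; have -> : expR (- (D * c0)) = (expR (D * c0))^-1 by rewrite expRN.
  by field; rewrite gt_eqF ?expR_gt0.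
have GL := Gz L; rewrite zL in GL.
have q0 : 0 < sqn L.
  rewrite lt_def sqn_ge0 andbT; apply: contraTneq Gp0 => Lq.
  rewrite -(pmulr_lgt0 _ (expR_gt0 (D * c0))) GL Lq expr0n gtn_eqF //.
  by rewrite mul0r mulr0 ltxx.
have KL0 : 0 < K L.
  rewrite -(pmulr_lgt0 (K L) (_ : 0 < sqn L ^+ n k * expR (- (D * sqn L)))).
    by rewrite -GL mulr_gt0 // expR_gt0.
  by rewrite mulr_gt0 ?exprn_gt0 ?expR_gt0.
pose rho := (n k)%:R / D.
have rho0 : 0 < rho by rewrite divr_gt0.
have Drho : D * rho = (n k)%:R by rewrite /rho [LHS]mulrC divfK ?gt_eqF.
have [x [x0 x1 Lx]] : exists x, [/\ 0 < x, x < 1 & sqn L = x * rho].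
  exists (sqn L / rho); split; first exact: divr_gt0.
    by rewrite ltr_pdivrMr // mul1r ltr_pdivlMr // mulrC.
  by rewrite divfK ?gt_eqF.
(* On |y|^2 = rho the removed factor is rho^n e^(-n), at [L] it is (x rho)^n e^(-n x), where n =
   n_k; maximality of [p] bounds K y by K L times their quotient. *)
have : K L <= K L * (x * expR (1 - x)) ^+ n k.
  apply: (@expoly_max_principle _ _ _ _ _ _ _ rho); last first.
    by rewrite Lx ger_pMl // ltW.
  move=> y yr; rewrite -/(K y).
  have E0 : 0 < rho ^+ n k * expR (- (n k)%:R) by rewrite mulr_gt0 ?exprn_gt0 ?expR_gt0.
  rewrite -(ler_pM2r E0); have := Gz y; rewrite yr Drho => <-.
  have -> : K L * (x * expR (1 - x)) ^+ n k * (rho ^+ n k * expR (- (n k)%:R)) =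
      gaussian n a b D p * expR (D * c0).
    rewrite GL Lx !exprMn -expRM_natl.
    have -> : - (D * (x * rho)) = (n k)%:R * (1 - x) + - (n k)%:R.
      by rewrite mulrCA Drho; ring.
    by rewrite expRD; ring.
  by rewrite ler_wpM2r ?expR_ge0.
apply/negP; rewrite -ltNge gtr_pMr // exprn_ilt1 -?lt0n //.
- by rewrite mulr_ge0 ?expR_ge0 // ltW.
- by rewrite mulr_expR1B_lt1 // lt_eqF.
Qed.

(** * Affine forms and hyperplanes *)

(** This supplies a point where the Gaussian product is positive. If the new form vanishes at [z], a
    move along its normal by a large real [t] makes it equal to [t] and passes the zeros of the
    other forms. *)
Lemma affine_avoid (R : realType) d N (a : 'I_N -> R[i]) (b : 'I_N -> 'rV[R[i]]_d)
    (s : seq 'I_N) :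
  (forall k, hsq (b k) = 1) ->
  exists z, forall k, k \in s -> a k + dotu z (b k) != 0.
Proof.
move=> b1; elim: s => [|k s [z zP]]; first by exists 0.
have [lk|lk] := eqVneq (a k + dotu z (b k)) 0; last first.
  by exists z => j; rewrite inE => /orP[/eqP ->//|/zP].
pose v := conjv (b k).
(* Exceeds the modulus of every root along the line. A form constant along [v] contributes 0,
   division by 0 being 0. *)
pose t := 1 + \sum_(j <- s) `|(a j + dotu z (b j)) / dotu v (b j)|.
have t_ge1 : 1 <= t by rewrite lerDl sumr_ge0.
have t0 : 0 < t by exact: lt_le_trans t_ge1.
exists (z + t *: v) => j; rewrite dotuDl dotuZl addrA inE.
have [-> _|jk /= js] := eqVneq j k.
  by rewrite lk add0r dotu_conjv // mulr1 gt_eqF.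
have [->|vj] := eqVneq (dotu v (b j)) 0; first by rewrite mulr0 addr0 zP.
apply/negP => /eqP /(canRL (addKr _)); rewrite addr0 => tv.
have tE : t = - ((a j + dotu z (b j)) / dotu v (b j)) by rewrite -mulNr -tv mulfK.
have : t < t.
  rewrite {1}tE (@le_lt_trans _ _ `|(a j + dotu z (b j)) / dotu v (b j)|) //.
    by rewrite -normrN real_ler_norm // -tE gtr0_real.
  rewrite /t (big_rem j) //= addrCA ltrDl ltr_wpDr // sumr_ge0 //.
by rewrite ltxx.
Qed.

Lemma hyperplane_annihilator (F : fieldType) d (V : {vspace 'rV[F]_d}) :
  (\dim V < d)%N ->
  exists2 c : 'rV[F]_d, c != 0 & forall v, v \in V -> \sum_j v 0 j * c 0 j = 0.
Proof.
move=> dimV; pose A := \matrix_(i < \dim V) (vbasis V)`_i.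
have : kermx A^T != 0.
  rewrite kermx_eq0; apply: contraL dimV => /eqP rA.
  by rewrite -leqNgt -[X in (X <= _)%N]rA rank_leq_col.
case/rowV0Pn => c /sub_kermxP cA c0; exists c => // v vV.
rewrite (coord_vbasis vV).
under eq_bigr do rewrite summxE mulr_suml.
rewrite exchange_big big1 //= => i _.
have := congr1 (fun r : 'rV_(\dim V) => coord (vbasis V) i v * r 0 i) cA.
rewrite !mxE mulr0 mulr_sumr => {2}<-.
by apply: eq_bigr => j _; rewrite !mxE -mulrA [_ * c 0 j]mulrC.
Qed.

(** Cauchy-Schwarz: [v] minus its projection on [conjv b] has nonnegative square norm. *)
Lemma sqn_dotu_le (R : realType) d (v b : 'rV[R[i]]_d) : hsq b = 1 ->
  sqn (dotu v b) <= hsq v.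
Proof.
move=> b1; have := hsq_ge0 (v + - dotu v b *: conjv b).
rewrite hsqD_scale_conjv //; case: (dotu v b) => x y; rewrite /sqn /=; nra.
Qed.

(** With [b] a normalized annihilator of the direction space, the form at [z] equals
    [dotu (z - w) b] for every [w] in [H]. Cauchy-Schwarz and the infimum over [w] conclude. *)
Lemma hyperplane_equation (R : realType) d (H : set 'rV[R[i]]_d) :
  affine_hyperplane H ->
  exists a (b : 'rV[R[i]]_d), hsq b = 1 /\
    forall delta z, 0 < delta -> neighborhood delta H z ->
      sqn (a + dotu z b) <= delta ^+ 2.
Proof.
move=> [y [V [dimV ->]]].
have [|c c0 cV] := @hyperplane_annihilator _ _ V.
  by move/eqP: dimV; rewrite eqn_leq => /andP[].
have hc : 0 < hsq c.
  case/rV0Pn: c0 => j cj.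
  by rewrite /hsq (bigD1 j) //= ltr_pwDl ?sqn_gt0 // sumr_ge0 // => l _; exact: sqn_ge0.
pose t : R[i] := ((Num.sqrt (hsq c))^-1)%:C%C.
pose b := t *: c.
have b1 : hsq b = 1.
  by rewrite hsqZ /sqn /= expr0n addr0 exprVn sqr_sqrtr ?ltW // mulVf // gt_eqF.
have bV v : v \in V -> dotu v b = 0.
  by move=> vV; rewrite dotuZr [dotu v c]cV // mulr0.
exists (- dotu y b), b; split=> // delta z delta0; rewrite /neighborhood /= => zH.
have le_dist : Num.sqrt (sqn (- dotu y b + dotu z b)) <= edist_to z
    [set y + v | v in [set v | v \in V]].
  apply: lb_le_inf.
    by exists (enorm (z - y)), y => //; exists 0 => /=; [exact: mem0v|exact: addr0].
  move=> _ [_ [v /= vV <-] <-].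
  have -> : - dotu y b + dotu z b = dotu (z - (y + v)) b.
    have -> : z - (y + v) = z + (-1) *: (y + v) by rewrite scaleN1r.
    by rewrite dotuDl dotuZl dotuDl (bV v vV) addr0 mulN1r addrC.
  rewrite /enorm ler_sqrt ?sumr_ge0 // => [|j _]; last exact: sqr_ge0.
  by under eq_bigr do rewrite sqn_normc; exact: sqn_dotu_le.
rewrite -(@sqr_sqrtr _ (sqn _)) ?sqn_ge0 //.
by rewrite ler_pXn2r ?nnegrE ?sqrtr_ge0 ?(ltW delta0) // (le_trans le_dist).
Qed.

(** * Choice of the exponents and conclusion *)

(** Rounding each D delta_k^2 up to a strictly larger integer costs at most 1, hence N in total, and
    D (r^2 - s) > N absorbs it. *)
Lemma integer_weights (R : realType) N (delta : 'I_N -> R) (r : R) :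
  \sum_(k < N) delta k ^+ 2 < r ^+ 2 ->
  exists (D : nat) (n : 'I_N -> nat), [/\ (0 < D)%N, forall k, (0 < n k)%N,
    forall k, D%:R * delta k ^+ 2 < (n k)%:R &
    (\sum_k n k)%:R <= D%:R * r ^+ 2].
Proof.
set s := \sum_(k < N) _ => sr.
pose x : R := N%:R / (r ^+ 2 - s).
have rs : 0 < r ^+ 2 - s by rewrite subr_gt0.
have x0 : 0 <= x by rewrite divr_ge0 // ltW.
pose D := (Num.truncn x).+1.
have xD : x < D%:R by exact: truncnS_gt.
have Dd0 k : 0 <= D%:R * delta k ^+ 2 by rewrite mulr_ge0 ?sqr_ge0.
exists D, (fun k => (Num.truncn (D%:R * delta k ^+ 2)).+1); split=> // [k|].
  exact: truncnS_gt.
rewrite natr_sum.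
apply: (@le_trans _ _ (\sum_(k < N) (D%:R * delta k ^+ 2 + 1))).
  by apply: ler_sum => k _; rewrite -natr1 lerD2r truncn_le.
rewrite big_split /= -mulr_sumr -/s sumr_const card_ord.
by move: xD; rewrite /x ltr_pdivrMr // mulrBr; lra.
Qed.

Theorem corollary1p5 (R : realType) (d N : nat) (r : R) (delta : 'I_N -> R)
    (C : 'I_N -> set 'rV[R[i]]_d) :
  0 < r ->
  (forall k : 'I_N, 0 < delta k) ->
  \sum_(k < N) delta k ^+ 2 < r ^+ 2 ->
  (forall k : 'I_N, exists H : set 'rV[R[i]]_d,
      affine_hyperplane H /\ C k = neighborhood (delta k) H) ->
  ~ (closed_eball r `<=` \bigcup_(k in [set: 'I_N]) C k).
Proof.
move=> r0 delta0 sum_lt CH cover.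
have [D [n [D0 n0 nD nr]]] := integer_weights sum_lt.
have hsqE (z : 'rV[R[i]]_d) : enorm z = Num.sqrt (hsq z).
  by rewrite /enorm; under eq_bigr do rewrite sqn_normc.
have ball (z : 'rV[R[i]]_d) : D%:R * hsq z <= D%:R * r ^+ 2 -> closed_eball r z.
  rewrite ler_pM2l ?ltr0n // => zr; change (enorm z <= r); rewrite hsqE.
  by rewrite -[leRHS]ger0_norm ?(ltW r0) // -sqrtr_sqr ler_sqrt // sqr_ge0.
have eqn k : exists ab : R[i] * 'rV[R[i]]_d, hsq ab.2 = 1 /\
    forall z, C k z -> sqn (ab.1 + dotu z ab.2) <= delta k ^+ 2.
  have [H [Hh ->]] := CH k; have [a [b [b1 Hab]]] := hyperplane_equation Hh.
  by exists (a, b); split=> // z; exact: Hab.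
have [ab abP] := choice eqn.
pose a k := (ab k).1; pose b k := (ab k).2.
have b1 k : hsq (b k) = 1 by case: (abP k).
have [z0 z0P] := affine_avoid a (index_enum _) b1.
have Gz0 : 0 < gaussian n a b D%:R z0.
  rewrite gaussianE mulr_gt0 ?expR_gt0 // prodr_gt0 // => k _.
  by rewrite exprn_gt0 // sqn_gt0 z0P // mem_index_enum.
have DR0 : 0 < D%:R :> R by rewrite ltr0n.
(* The cover of the origin yields an index, so N > 0 and the total exponent is positive. *)
have [k0 _ _] : (\bigcup_(k in [set: 'I_N]) C k) 0.
  apply/cover/ball; rewrite ler_pM2l // /hsq big1 ?sqr_ge0 // => j _.
  by rewrite mxE sqn0.
have M0 : (0 < \sum_k n k)%N by rewrite (bigD1 k0) //= addn_gt0 n0.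
have [p [Gp pM Gmax]] := gaussian_global_max DR0 M0 Gz0.
have [k _ Ckp] : (\bigcup_(k in [set: 'I_N]) C k) p.
  by apply/cover/ball; exact: le_trans pM nr.
have [_ /(_ _ Ckp) near_k] := abP k.
have := gaussian_max_far DR0 (n0 k) (b1 k) Gp Gmax.
rewrite leNgt => /negP; apply; apply: le_lt_trans (nD k).
by rewrite ler_pM2l.
Qed.
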